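(* Let $Q$ be an involutory quandle and let $i:Q\to\mathrm{Core}(\mathcal{H}(Q))$, $x\mapsto e_x$. Then $Q$ can be embedded into a core quandle (i.e. there is an injective quandle homomorphism $Q\to\mathrm{Core}(G)$ for some group $G$) if and only if $\ker i=0_Q$.
   Context: A quandle is a set $Q$ with a binary operation $*$ such that every left translation $L_x:y\mapsto x*y$ is bijective, $x*(y*z)=(x*y)*(x*z)$ and $x*x=x$ for all $x,y,z\in Q$. It is involutory if $L_x^2=1$ for all $x$. For a group $G$, $\mathrm{Core}(G)$ is the quandle with underlying set $G$ and operation $x*y=xy^{-1}x$. For a quandle $Q$, $\mathcal{H}(Q)$ is the group given by generators and relations $\mathcal{H}(Q)=\langle e_x,\ x\in Q \mid e_{x*y}=e_xe_y^{-1}e_x,\ x,y\in Q\rangle$. The map $i$ is a quandle homomorphism. $\ker i=\{(x,y)\in Q\times Q : i(x)=i(y)\}$, and $0_Q$ is the identity (equality) relation on $Q$. *)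

(* Defs.v *)
From HB Require Import structures.
From mathcomp Require Import all_boot.
From mathcomp Require Import boolp classical_sets.

Set Implicit Arguments.
Unset Strict Implicit.
Unset Printing Implicit Defensive.

Declare Scope quandle_scope.
Delimit Scope quandle_scope with Q.
Local Open Scope quandle_scope.

HB.mixin Record isQuandle Q := {
  qop : Q -> Q -> Q;
  qop_bij : forall x, bijective (qop x);
  qopD : forall x y z, qop x (qop y z) = qop (qop x y) (qop x z);
  qopxx : forall x, qop x x = x
}.

#[short(type="quandleType")]
HB.structure Definition Quandle := {Q of isQuandle Q}.

Notation "x |> y" := (qop x y)
  (at level 40, left associativity) : quandle_scope.

Definition involutory (Q : quandleType) : Prop :=
  forall x : Q, involutive (qop x).

Definition quandle_hom (Q Q' : quandleType) (f : Q -> Q') : Prop :=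
  {morph f : x y / x |> y}.

Definition ker (X Y : Type) (f : X -> Y) : set (X * X) :=
  [set p | f p.1 = f p.2].

Section Core.
Variable G : groupType.
Implicit Types x y z : G.

Definition Core : Type := G.

Definition core_op x y : G := (x * y^-1 * x)%g.

Fact core_opK x : involutive (core_op x).
Proof. by move=> y; rewrite /core_op !invgM invgK !mulgA mulgV mul1g mulgVK. Qed.

Fact core_op_bij x : bijective (core_op x).
Proof. exact: inv_bij (core_opK x). Qed.

Fact core_opD x y z :
  core_op x (core_op y z) = core_op (core_op x y) (core_op x z).
Proof. by rewrite /core_op !invgM !invgK !mulgA !(mulgVK, mulgK). Qed.

Fact core_opxx x : core_op x x = x.
Proof. by rewrite /core_op mulgV mul1g. Qed.

HB.instance Definition _ :=
  isQuandle.Build Core core_op_bij core_opD core_opxx.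

End Core.

(* The group < X | u = v for all u, v with R u v >, as the quotient of the    *)
(* words in the letters x and x^-1 (x : X) by the congruence generated by     *)
(* free cancellation and R. The letter (x, b) stands for x if b = false and   *)
(* for x^-1 if b = true. Words are over {classic X} rather than X only        *)
(* because quotients require a choiceType.                                    *)
Definition word (X : Type) := seq ({classic X} * bool).

Inductive pres_eq (X : Type) (R : word X -> word X -> Prop) :
    word X -> word X -> Prop :=
| pres_rel u v : R u v -> pres_eq R u v
| pres_cancel x b : pres_eq R [:: (x, b); (x, ~~ b)] [::]
| pres_cat u u' v v' :
    pres_eq R u u' -> pres_eq R v v' -> pres_eq R (u ++ v) (u' ++ v')
| pres_refl u : pres_eq R u u
| pres_sym u v : pres_eq R u v -> pres_eq R v u
| pres_trans u v w : pres_eq R u v -> pres_eq R v w -> pres_eq R u w.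

Section PresentedGroup.
Local Open Scope quotient_scope.
Variables (X : Type) (R : word X -> word X -> Prop).

Definition pres_eqb : rel (word X) := fun u v => `[< pres_eq R u v >].

Fact pres_eqb_refl : reflexive pres_eqb.
Proof. by move=> u; apply/asboolP/pres_refl. Qed.

Fact pres_eqb_sym : symmetric pres_eqb.
Proof. by move=> u v; apply/asboolP/asboolP => /pres_sym. Qed.

Fact pres_eqb_trans : transitive pres_eqb.
Proof.
by move=> v u w /asboolP uv /asboolP vw; apply/asboolP/(pres_trans uv vw).
Qed.

Canonical pres_equiv :=
  EquivRel pres_eqb pres_eqb_refl pres_eqb_sym pres_eqb_trans.

Definition presented_group : Type := {eq_quot pres_equiv}.
HB.instance Definition _ := EqQuotient.on presented_group.
HB.instance Definition _ := Choice.on presented_group.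

Definition pres_class (u : word X) : presented_group := \pi u.

Definition pres_gen (x : X) : presented_group := pres_class [:: (x, false)].

Definition inv_word (u : word X) : word X :=
  rev [seq (a.1, ~~ a.2) | a <- u].

Definition pres_one : presented_group := pres_class [::].
Definition pres_mul (a b : presented_group) : presented_group :=
  pres_class (repr a ++ repr b).
Definition pres_inv (a : presented_group) : presented_group :=
  pres_class (inv_word (repr a)).

Lemma pres_classP u v : pres_class u = pres_class v <-> pres_eq R u v.
Proof. by split=> [/eqmodP/asboolP|uv] //; apply/eqmodP/asboolP. Qed.

Lemma pres_repr u : pres_eq R (repr (pres_class u)) u.
Proof. by apply/pres_classP; rewrite /pres_class reprK. Qed.

Lemma pres_mulE u v :
  pres_mul (pres_class u) (pres_class v) = pres_class (u ++ v).
Proof. by apply/pres_classP; apply: pres_cat; apply: pres_repr. Qed.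

Lemma inv_wordK : involutive inv_word.
Proof.
move=> u; rewrite /inv_word map_rev revK -map_comp map_id_in // => -[x b] _ /=.
by rewrite negbK.
Qed.

Lemma pres_eq_invl u : pres_eq R (inv_word u ++ u) [::].
Proof.
rewrite /inv_word; elim: u => [|[x b] u IHu]; first exact: pres_refl.
rewrite /= rev_cons -cats1 -catA -(cat1s (x, b)) (catA [:: _]).
apply: pres_trans IHu; apply: pres_cat; first exact: pres_refl.
have c := pres_cancel R x (~~ b); rewrite negbK in c.
exact: (pres_cat c (pres_refl R u)).
Qed.

Lemma pres_eq_invr u : pres_eq R (u ++ inv_word u) [::].
Proof. by have := pres_eq_invl (inv_word u); rewrite inv_wordK. Qed.

Lemma pres_eq_inv u v : pres_eq R u v -> pres_eq R (inv_word u) (inv_word v).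
Proof.
move=> uv; rewrite -[inv_word u]cats0.
apply: pres_trans (pres_cat (pres_refl R _) (pres_sym (pres_eq_invr v))) _.
rewrite catA -[X in pres_eq _ _ X]cat0s.
apply: pres_cat (pres_refl R _); apply: pres_trans (pres_eq_invl u).
exact: pres_cat (pres_refl R _) (pres_sym uv).
Qed.

Lemma pres_invE u : pres_inv (pres_class u) = pres_class (inv_word u).
Proof. by apply/pres_classP; apply/pres_eq_inv/pres_repr. Qed.

Lemma pres_ind (P : presented_group -> Prop) :
  (forall u, P (pres_class u)) -> forall a, P a.
Proof. by move=> Pc a; rewrite -[a]reprK; apply: Pc. Qed.

Fact pres_mulA : associative pres_mul.
Proof.
elim/pres_ind=> u; elim/pres_ind=> v; elim/pres_ind=> w.
by rewrite !pres_mulE catA.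
Qed.

Fact pres_mul1 : left_id pres_one pres_mul.
Proof. by elim/pres_ind=> u; rewrite pres_mulE. Qed.

Fact pres_mulr1 : right_id pres_one pres_mul.
Proof. by elim/pres_ind=> u; rewrite pres_mulE cats0. Qed.

Fact pres_mulV : left_inverse pres_one pres_inv pres_mul.
Proof.
elim/pres_ind=> u; rewrite pres_invE pres_mulE.
exact/pres_classP/pres_eq_invl.
Qed.

Fact pres_mulrV : right_inverse pres_one pres_inv pres_mul.
Proof.
elim/pres_ind=> u; rewrite pres_invE pres_mulE.
exact/pres_classP/pres_eq_invr.
Qed.

HB.instance Definition _ := isGroup.Build presented_group
  pres_mulA pres_mul1 pres_mulr1 pres_mulV pres_mulrV.

End PresentedGroup.

Section QuandleGroup.
Variable Q : quandleType.

(* e_{x * y} = e_x e_y^-1 e_x *)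
Inductive HQ_rel : word Q -> word Q -> Prop :=
  HQRel (x y : Q) :
    HQ_rel [:: (x |> y, false)] [:: (x, false); (y, true); (x, false)].

Definition HQ : groupType := presented_group HQ_rel.

Definition i_map (x : Q) : Core HQ := pres_gen HQ_rel x.

Lemma i_map_hom : quandle_hom i_map.
Proof.
move=> x y; rewrite /i_map /qop /= /core_op /mul /inv /=.
rewrite /pres_gen pres_invE !pres_mulE; apply/pres_classP/pres_rel.
exact: HQRel.
Qed.

End QuandleGroup.

(* Main.v *)
(* Relations of H(Q) say exactly that [i] is a homomorphism to a core quandle,
   so every homomorphism from Q to a core quandle factors through [i]; if it is
   injective, so is [i]. *)
Require Import Defs.
From mathcomp Require Import all_boot.
From mathcomp Require Import boolp classical_sets.

(** A homomorphism [f] from [Q] to [Core G] evaluates words over [Q] in [G], compatibly with the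
    relations of [HQ Q]; hence equal generators have equal images under [f] ([i_map_factor]).
    Conversely, if the kernel is trivial, [i_map] itself is an embedding. *)

Section WordEvaluation.
Local Open Scope group_scope.
Variables (X : Type) (G : groupType) (f : X -> G).

Definition word_eval (u : word X) : G :=
  foldr (fun a g => (if a.2 then (f a.1)^-1 else f a.1) * g) 1 u.

Lemma word_eval_cat u v : word_eval (u ++ v) = word_eval u * word_eval v.
Proof. by elim: u => [|a u IHu] /=; rewrite ?mul1g // IHu mulgA. Qed.

(** Universal property of the presentation, on words: free cancellation holds in any group, so only
    [R] needs checking. *)
Lemma pres_eq_word_eval (R : word X -> word X -> Prop) (u v : word X) :
  (forall u v, R u v -> word_eval u = word_eval v) ->
  pres_eq R u v -> word_eval u = word_eval v.
Proof.
move=> fR; elim=> {u v} [u v /fR //|x b|u u' v v' _ IHu _ IHv|//|//|].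
- by case: b; rewrite /= mulg1 ?mulVg ?mulgV.
- by rewrite !word_eval_cat IHu IHv.
- by move=> u v w _ -> _ ->.
Qed.

End WordEvaluation.

Lemma i_map_factor (Q : quandleType) (G : groupType) (f : Q -> Core G) x y :
  quandle_hom f -> i_map x = i_map y -> f x = f y.
Proof.
move=> fM /pres_classP /(pres_eq_word_eval Q G f _ _ _) /=.
rewrite !mulg1; apply=> _ _ [a b] /=.
(* Up to bracketing, the evaluated relation is the homomorphism law of [f] into [Core G]. *)
by rewrite !mulg1 mulgA; apply: fM.
Qed.

Theorem corollary6p3 (Q : quandleType) (invQ : involutory Q) :
  (exists (G : groupType) (f : Q -> Core G), quandle_hom f /\ injective f)
  <-> ker (@i_map Q) = diagonal.
Proof.
split=> [[G [f [fM f_inj]]]|ker_i].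
  apply/seteqP; split=> -[x y] xy; last exact: (congr1 (@i_map Q) xy).
  exact: f_inj (i_map_factor _ _ _ _ _ fM xy).
exists (HQ Q), (@i_map Q); split=> [|x y ixy]; first exact: i_map_hom.
by have : ker (@i_map Q) (x, y) by []; rewrite ker_i.
Qed.
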